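(* Let $P\subset\mathbb{R}^d$ be a simple polytope (not necessarily a lattice polytope). Then $P$ has the clique-face property, i.e. every clique of the $1$-skeleton $\mathrm{sk}(P)$ is the vertex set of a face of $P$.
   Context: The $1$-skeleton $\mathrm{sk}(P)$ of a convex polytope $P$ is the finite simple graph on the vertices of $P$ with two distinct vertices $v,w$ adjacent iff $\mathrm{conv}(\{v,w\})$ is an edge ($1$-dimensional face) of $P$. $P$ is simple if every vertex of $\mathrm{sk}(P)$ has degree $\dim P$. A clique of a graph is the vertex set of a complete subgraph. $P$ itself is regarded as a face of $P$. *)

(* Defs.v *)
From mathcomp Require Import all_boot all_order all_algebra.
From mathcomp Require Import boolp classical_sets cardinality reals.
From mathcomp Require Import interval_inference convex.

Set Implicit Arguments.
Unset Strict Implicit.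
Unset Printing Implicit Defensive.

Import Order.TTheory GRing.Theory Num.Theory.

Local Open Scope classical_set_scope.
Local Open Scope ring_scope.

Record sgraph (T : Type) := SGraph {
  gvertex : set T;
  gadj : T -> T -> Prop;
  gadj_vertex : forall x y, gadj x y -> gvertex x;
  gadj_sym : forall x y, gadj x y -> gadj y x;
  gadj_irr : forall x, ~ gadj x x }.

Section Graph.
Variable (T : Type).
Implicit Types (G : sgraph T) (K : set T).

Definition has_degree G (x : T) (n : nat) : Prop :=
  ([set y | gadj G x y] #= `I_n)%card.

Definition is_clique G K : Prop :=
  K `<=` gvertex G /\ (forall x y, K x -> K y -> x <> y -> gadj G x y).

End Graph.

Section Polytope.
Variables (R : realType) (d : nat).
Implicit Types (A P F : set 'rV[R]_d) (c v w x : 'rV[R]_d).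

Definition dotp c x : R := (c *m x^T) 0 0.

Definition conv_hull A : set 'rV[R]_d :=
  smallest (@convex_set R 'rV[R]_d) A.

Definition is_polytope P : Prop :=
  exists2 A, finite_set A & P = conv_hull A.

(* c = 0 is allowed, so that P itself (b = 0) and set0 (b = 1) are faces. *)
Definition is_face P F : Prop :=
  exists c b, (forall x, P x -> dotp c x <= b) /\
              F = P `&` [set x | dotp c x = b].

Definition affine_indep k (p : 'I_k.+1 -> 'rV[R]_d) : Prop :=
  row_free (\matrix_(i < k) (p (lift ord0 i) - p ord0)).

(* The largest k such that A contains k + 1 affinely independent points.
   Note that affdim set0 = 0 (not -1). *)
Definition affdim A : nat :=
  \max_(k < d.+1 | `[< exists2 p : 'I_k.+1 -> 'rV[R]_d,
                       (forall i, A (p i)) & affine_indep p >]) k.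

(* Written with singletons rather than affdim F = 0, which set0 satisfies. *)
Definition vertices P : set 'rV[R]_d := [set v | is_face P [set v]].

Definition is_edge P F : Prop := is_face P F /\ affdim F = 1%N.

Definition sk_adj P v w : Prop :=
  [/\ vertices P v, vertices P w, v <> w & is_edge P (conv_hull [set v; w])].

Lemma sk_adj_vertex P v w : sk_adj P v w -> vertices P v.
Proof. by case. Qed.

Lemma sk_adj_sym P v w : sk_adj P v w -> sk_adj P w v.
Proof. by case=> Pv Pw vw e; split=> //; [exact/nesym | rewrite setUC]. Qed.

Lemma sk_adj_irr P v : ~ sk_adj P v v.
Proof. by case. Qed.

Definition sk P : sgraph 'rV[R]_d :=
  SGraph (@sk_adj_vertex P) (@sk_adj_sym P) (@sk_adj_irr P).

Definition is_simple P : Prop :=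
  forall v, gvertex (sk P) v -> has_degree (sk P) v (affdim P).

Definition clique_face_property P : Prop :=
  forall K, is_clique (sk P) K -> exists2 F, is_face P F & K = vertices F.

Lemma dotpDZ c (a b : R) v w :
  dotp c (a *: v + b *: w) = a * dotp c v + b * dotp c w.
Proof. by rewrite /dotp linearD !linearZ /= mulmxDr -!scalemxAr !mxE. Qed.

Lemma convex_dotp_lt c (b : R) :
  @convex_set R 'rV[R]_d [set x | dotp c x < b].
Proof.
move=> x y t; rewrite !inE /= => xb yb; rewrite /conv /= dotpDZ /unstable.onem.
have t0 : 0 <= t%:num by [].
have t1 : 0 <= 1 - t%:num by rewrite subr_ge0.
have -> : b = t%:num * b + (1 - t%:num) * b by rewrite -mulrDl addrC subrK mul1r.
have [->|t10] := eqVneq t%:num 0; first by rewrite !mul0r !add0r subr0 !mul1r.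
apply: ltr_leD; last by apply: ler_wpM2l => //; exact: ltW.
by rewrite ltr_pM2l// lt_neqAle eq_sym t10.
Qed.

Lemma vertices_conv_hull A : vertices (conv_hull A) `<=` A.
Proof.
move=> v [c [b [cleb vE]]]; apply: contrapT => NAv.
have [hv cv] : (conv_hull A `&` [set x | dotp c x = b]) v by rewrite -vE.
have hA x : A x -> conv_hull A x by move=> Ax B [_]; exact.
suff : dotp c v < b by rewrite cv ltxx.
apply: (hv [set x | dotp c x < b]); split; first exact: convex_dotp_lt.
move=> x Ax /=; rewrite lt_neqAle cleb ?andbT; last exact: hA.
apply/eqP => cx; apply: NAv.
suff /= <- : [set v] x by [].
by rewrite vE; split=> //; exact: hA.
Qed.

Lemma finite_sk P : is_polytope P -> finite_set (gvertex (sk P)).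
Proof. by move=> [A Afin ->]; apply: sub_finite_set Afin; exact: vertices_conv_hull. Qed.

End Polytope.

(* Main.v *)
Require Import Defs.
From mathcomp Require Import all_boot all_order all_algebra.
From mathcomp Require Import boolp classical_sets functions cardinality reals.
From mathcomp Require Import interval_inference convex.
From mathcomp Require Import ring lra.

(** Let [n] be the dimension of the polytope [P] and [v] a vertex.  Seen from
    [v], the polytope lies in the cone spanned by the [n] edge directions
    [u - v], where [u] runs over the neighbours of [v]
    ([polytope_sub_tangent_cone]).  This cone spans an [n]-dimensional space,
    so for a simple [P] the [n] edge directions are linearly independent
    ([simple_vertex_basis]).  Hence one can prescribe the values of a linear
    form on the edge directions at [v]; if the values are nonnegative, the form
    is nonnegative on [x - v] for all [x] in [P] ([simple_vertex_functional]).

    Now let [K] be a clique and [v] one of its points.  The form [e] that is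
    [0] on [u - v] for the neighbours [u] in [K], and [1] for those outside
    [K], cuts out a face [F].  It contains [K], and [x - v] is a combination
    [\sum_u mu_u (u - v)] over [u] in [K], with [mu_u >= 0], for each [x] in
    [F].  If [K] contains another point [w], then all points of [K] other than
    [w] are neighbours of [w], and the linear form at [w] that is [1] on
    [v - w] and [0] on the other edges takes the value [1 - \sum_u mu_u] at
    [x - w]; hence [\sum_u mu_u <= 1].  So the points of [F] are convex
    combinations of points of [K], and the vertices of [F] are in [K].

    That the edges at [v] span the tangent cone is proved for [P] the convex
    hull of a finite family [a].  Choose an irredundant set of generators
    [a b - v] of the cone of all the [a i - v].  Each of them spans an extreme
    ray, and Gordan's theorem of the alternative yields a supporting
    hyperplane that meets the cone in this ray only
    ([irredundant_support]).  The point [a k] that is furthest from [v] on the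
    ray is a vertex joined to [v] by an edge
    ([exists_neighbour_on_ray]). *)

Set Implicit Arguments.
Unset Strict Implicit.
Unset Printing Implicit Defensive.

Import Order.TTheory GRing.Theory Num.Theory.

Local Open Scope ring_scope.

(** * The scalar product *)

Section Dot.
Variables (R : realType) (d : nat).
Implicit Types (c v w x y : 'rV[R]_d).

Lemma dotpC x y : dotp x y = dotp y x.
Proof.
by rewrite /dotp -[in LHS](trmxK (x *m y^T)) trmx_mul trmxK [in LHS]mxE.
Qed.

Lemma dotpDr c x y : dotp c (x + y) = dotp c x + dotp c y.
Proof. by have := dotpDZ c 1 1 x y; rewrite !scale1r !mul1r. Qed.

Lemma dotpZr c a x : dotp c (a *: x) = a * dotp c x.
Proof. by have := dotpDZ c a 0 x x; rewrite scale0r mul0r !addr0. Qed.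

Lemma dotp0r c : dotp c 0 = 0.
Proof. by have := dotpZr c 0 0; rewrite scale0r mul0r. Qed.

Lemma dotpBr c x y : dotp c (x - y) = dotp c x - dotp c y.
Proof. by rewrite -scaleN1r dotpDr dotpZr mulN1r. Qed.

Lemma dotpDl x y c : dotp (x + y) c = dotp x c + dotp y c.
Proof. by rewrite !(dotpC _ c) dotpDr. Qed.

Lemma dotpZl a x c : dotp (a *: x) c = a * dotp x c.
Proof. by rewrite !(dotpC _ c) dotpZr. Qed.

Lemma dotpBl x y c : dotp (x - y) c = dotp x c - dotp y c.
Proof. by rewrite !(dotpC _ c) dotpBr. Qed.

Lemma dotp_sumr c (I : finType) (Q : pred I) (F : I -> 'rV[R]_d) :
  dotp c (\sum_(i | Q i) F i) = \sum_(i | Q i) dotp c (F i).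
Proof. exact: (big_morph _ (dotpDr c) (dotp0r c)). Qed.

Lemma dotp_gt0 x : x != 0 -> 0 < dotp x x.
Proof.
move=> x0; have -> : dotp x x = \sum_j x 0 j ^+ 2.
  by rewrite /dotp mxE; apply: eq_bigr => j _; rewrite mxE expr2.
rewrite lt_neqAle sumr_ge0 ?andbT => [|j _]; last exact: sqr_ge0.
rewrite eq_sym psumr_neq0 => [|j _]; last exact: sqr_ge0.
have /rV0Pn[j xj] := x0.
by apply/hasP; exists j; rewrite ?mem_index_enum //= exprn_even_gt0.
Qed.

End Dot.

(** * Gordan's theorem of the alternative *)

Section Gordan.
Variables (R : realType) (d : nat) (T : finType).
Implicit Types (c b : 'rV[R]_d) (g : T -> 'rV[R]_d).

Lemma exists_small_step (Q : pred T) (x y : T -> R) :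
  (forall i, Q i -> x i < 0) ->
  exists2 e : R, 0 < e & forall i, Q i -> x i + e * y i < 0.
Proof.
move=> xn; pose s := \sum_(i | Q i) `|y i| / - x i.
have pos i : Q i -> 0 <= `|y i| / - x i.
  by move=> Qi; rewrite divr_ge0 // oppr_ge0 ltW // xn.
have s0 : 0 < 1 + s by rewrite ltr_pwDl // sumr_ge0.
exists (1 + s)^-1; first by rewrite invr_gt0.
move=> i Qi; have xi : 0 < - x i by rewrite oppr_gt0 xn.
have : `|y i| / - x i < 1 + s.
  rewrite /s (bigD1 i) //= addrCA ltr_pwDr //.
  by rewrite ltr_pwDl // sumr_ge0 // => j /andP[/pos].
rewrite ltr_pdivrMr // -ltr_pdivrMl // => lt.
rewrite -subr_gt0 sub0r opprD subr_gt0.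
apply: le_lt_trans lt; apply: ler_wpM2l; last exact: ler_norm.
by rewrite invr_ge0 ltW.
Qed.

(** By induction on the number of vectors.  Single out [g b] and let [c] be
    negative on the others.  If [c] is positive on [g b], slide each other
    vector along [g b] until it is orthogonal to [c].  A relation among the
    slid vectors is a relation among the original ones.  If on the contrary
    [c'] is negative on the slid vectors, it stays so when a multiple of [c] is
    subtracted, and the multiple can be chosen to make the value on [g b] equal
    to an arbitrarily small negative number.  If [c] vanishes on [g b], tilt [c]
    slightly away from [g b]. *)
Lemma gordan (Q : pred T) g :
  (exists c, forall i, Q i -> dotp c (g i) < 0) \/
  (exists l : T -> R, [/\ forall i, 0 <= l i, exists2 i, Q i & 0 < l i &
     \sum_(i | Q i) l i *: g i = 0]).
Proof.
have [n] := ubnP #|Q|; elim: n => // n IH in Q g *; rewrite ltnS => leQn.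
have [b Qb|Q0] := pickP Q; last by left; exists 0 => i; rewrite Q0.
pose Q' := [pred i | Q i && (i != b)].
have Q'n : (#|Q'| < n)%N.
  apply: leq_trans leQn; apply: proper_card; apply/properP; split.
    by apply/fintype.subsetP => i; rewrite !inE => /andP[].
  by exists b => //; rewrite !inE eqxx andbF.
have extend (k : R) (l : T -> R) : 0 <= k -> (forall i, 0 <= l i) ->
    (exists2 i, Q' i & 0 < l i) \/ 0 < k ->
    k *: g b + \sum_(i | Q' i) l i *: g i = 0 ->
    exists l : T -> R, [/\ forall i, 0 <= l i, exists2 i, Q i & 0 < l i &
     \sum_(i | Q i) l i *: g i = 0].
  move=> k0 l0 ex e0; exists (fun i => if i == b then k else l i); split.
  - by move=> i; case: eqP.
  - case: ex => [[i /andP[Qi ib] li]|kp]; last by exists b; rewrite ?eqxx.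
    by exists i => //; rewrite (negPf ib).
  - rewrite (bigD1 b) //= eqxx -[RHS]e0; congr (_ + _).
    by apply: eq_bigr => i /andP[_ /negPf->].
have [[c cn]|[l [l0 lp le]]] := IH Q' g Q'n; last first.
  by right; apply: (extend 0 l) => //; [left | rewrite scale0r add0r].
have [cb|cb|cb] := ltgtP (dotp c (g b)) 0.
- left; exists c => i Qi; have [->//|ib] := eqVneq i b.
  by apply: cn; rewrite /= Qi.
- pose s i := - dotp c (g i) / dotp c (g b).
  have s0 i : Q' i -> 0 < s i by move=> /cn ci; rewrite divr_gt0 // oppr_gt0.
  have [[c' c'n]|[l [l0 lp le]]] := IH Q' (fun i => g i + s i *: g b) Q'n.
    have [e e0 en] := exists_small_step s c'n.
    (* the coefficient makes the value on [g b] equal to [- e] *)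
    left; exists (c' - ((dotp c' (g b) + e) / dotp c (g b)) *: c) => i Qi.
    rewrite dotpBl dotpZl; have [->|ib] := eqVneq i b.
      by rewrite divfK ?gt_eqF // opprD addrA subrr add0r oppr_lt0.
    have Q'i : Q' i by rewrite /= Qi.
    have := en i Q'i; rewrite dotpDr dotpZr /s; congr (_ < 0).
    by field; rewrite gt_eqF.
  right; apply: (extend (\sum_(i | Q' i) l i * s i) l) => //.
  + by apply: sumr_ge0 => i /s0/ltW si; rewrite mulr_ge0.
  + by left.
  + rewrite scaler_suml -big_split /= -[RHS]le; apply: eq_bigr => i _.
    by rewrite scalerDr scalerA addrC.
- have [b0|b0] := eqVneq (g b) 0.
    right; apply: (extend 1 (fun=> 0)) => //; first by right.
    by rewrite b0 scaler0 add0r big1 // => i _; rewrite scale0r.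
  have [e e0 en] := exists_small_step (fun i => - dotp (g b) (g i)) cn.
  left; exists (c - e *: g b) => i Qi; rewrite dotpBl dotpZl.
  have [->|ib] := eqVneq i b.
    by rewrite cb sub0r oppr_lt0 mulr_gt0 ?dotp_gt0.
  by rewrite -mulrN; apply: en; rewrite /= Qi.
Qed.

(** Gordan's alternative in the quotient by the line through [b], realised as
    the orthogonal complement of [b]. *)
Lemma gordan_orthogonal (Q : pred T) g b :
  (exists2 c, dotp c b = 0 & forall i, Q i -> dotp c (g i) < 0) \/
  (exists l : T -> R, [/\ forall i, 0 <= l i, exists2 i, Q i & 0 < l i &
     exists t, \sum_(i | Q i) l i *: g i = t *: b]).
Proof.
have [->|b0] := eqVneq b 0.
  have [[c cn]|[l [l0 lp le]]] := gordan Q g; [left|right].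
    by exists c => //; rewrite dotp0r.
  by exists l; split => //; exists 0; rewrite scaler0.
have bb := dotp_gt0 b0; pose q i := dotp b (g i) / dotp b b.
have [[c cn]|[l [l0 lp le]]] := gordan Q (fun i => g i - q i *: b).
  left; exists (c - (dotp c b / dotp b b) *: b) => [|i /cn].
    by rewrite dotpBl dotpZl divfK ?subrr // gt_eqF.
  rewrite dotpBr dotpBl !dotpZl dotpZr; congr (_ < 0); rewrite /q.
  by field; rewrite gt_eqF.
right; exists l; split => //; exists (\sum_(i | Q i) l i * q i).
apply/eqP; rewrite -subr_eq0 scaler_suml -sumrB -[X in _ == X]le; apply/eqP.
by apply: eq_bigr => i _; rewrite scalerBr scalerA.
Qed.

End Gordan.

(** * Finitely generated cones *)

Section Cone.
Variables (R : realType) (d : nat) (T : finType).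
Implicit Types (h c x y : 'rV[R]_d) (g : T -> 'rV[R]_d) (Q : pred T).

Definition cone Q g y : Prop :=
  exists2 l : T -> R, (forall i, 0 <= l i) & y = \sum_(i | Q i) l i *: g i.

Lemma cone_gen Q g i : Q i -> cone Q g (g i).
Proof.
move=> Qi; exists (fun j => (j == i)%:R) => //.
rewrite (bigD1 i) //= eqxx scale1r.
by rewrite big1 ?addr0 // => j /andP[_ /negPf->]; rewrite scale0r.
Qed.

Lemma coneZ Q g k y : 0 <= k -> cone Q g y -> cone Q g (k *: y).
Proof.
move=> k0 [l l0 ->]; exists (fun i => k * l i) => [i|]; first exact: mulr_ge0.
by rewrite scaler_sumr; apply: eq_bigr => i _; rewrite scalerA.
Qed.

Lemma cone_sum Q g (I : finType) (D : pred I) (F : I -> 'rV[R]_d) :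
  (forall i, D i -> cone Q g (F i)) -> cone Q g (\sum_(i | D i) F i).
Proof.
move=> DF; elim/big_ind: _ => //.
  by exists (fun=> 0) => //; rewrite big1 // => i _; rewrite scale0r.
move=> x y [k k0 ->] [l l0 ->]; exists (fun i => k i + l i) => [i|].
  exact: addr_ge0.
by rewrite -big_split; apply: eq_bigr => i _; rewrite scalerDl.
Qed.

(** This is the form in which pointedness of the cone is used: without its apex,
    the cone lies in an open half-space. *)
Lemma cone_lt0 Q g h y : (forall i, g i != 0 -> dotp h (g i) < 0) ->
  cone Q g y -> y != 0 -> dotp h y < 0.
Proof.
move=> hg [l l0 ->] y0.
have /existsP[i /andP[Qi li]] : [exists i, Q i && (l i *: g i != 0)].
  apply: contraNT y0; rewrite negb_exists => /forallP E; rewrite big1 // => i Qi.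
  by apply/eqP; move: (E i); rewrite Qi negbK.
have term j : dotp h (l j *: g j) <= 0.
  rewrite dotpZr; have [->|gj] := eqVneq (g j) 0; first by rewrite dotp0r mulr0.
  by rewrite mulr_ge0_le0 // ltW // hg.
rewrite dotp_sumr (bigD1 i) //= ltr_nwDl //; last by apply: sumr_le0 => j _.
move: li; rewrite scaler_eq0 negb_or => /andP[li gi].
by rewrite dotpZr pmulr_rlt0 ?hg // lt_neqAle eq_sym li l0.
Qed.

End Cone.

Lemma cone_trans (R : realType) (d : nat) (S T : finType) (Q : pred S)
    (Q' : pred T) (g : S -> 'rV[R]_d) (g' : T -> 'rV[R]_d) y :
  cone Q g y -> (forall i, Q i -> cone Q' g' (g i)) -> cone Q' g' y.
Proof. by move=> [l l0 ->] gg; apply: cone_sum => i /gg; apply: coneZ. Qed.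

(** * Extreme rays of a pointed cone *)

Section ExtremeRays.
Variables (R : realType) (d : nat) (T : finType) (g : T -> 'rV[R]_d).
Variables (h : 'rV[R]_d).
Hypothesis hg : forall i, g i != 0 -> dotp h (g i) < 0.

Definition irredundant (B : {set T}) : Prop :=
  (forall i, cone (mem B) g (g i)) /\
  (forall b, b \in B -> ~ cone (mem (B :\ b)) g (g b)).

Lemma exists_irredundant : exists B, irredundant B.
Proof.
pose gen (B : {set T}) := `[< forall i, cone (mem B) g (g i) >].
have genT : gen [set: T]%SET by apply/asboolP => i; apply: cone_gen; rewrite inE.
case: (arg_minnP (fun B : {set T} => #|B|) genT) => B /asboolP genB minB.
exists B; split => // b bB gb; have : gen (B :\ b).
  apply/asboolP => i; apply: cone_trans (genB i) _ => j jB.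
  have [->//|jb] := eqVneq j b.
  by apply: cone_gen; rewrite /= !inE jb.
by move=> /minB; rewrite leqNgt (cardsD1 b B) bB add1n ltnSn.
Qed.

(** If there were no such [c], Gordan's alternative would give a positive
    combination of generators off the ray of [g b] equal to [t *: g b].
    Split each of these generators [g i] as [m i *: g b] plus an element of the
    cone over [B :\ b], which is nonzero since [g i] is off the ray.  Collecting
    the multiples of [g b] gives a vector [Z] of the cone over [B :\ b] that is
    a multiple of [g b]; by pointedness [h] is negative on [Z] and on [g b], so
    the factor is positive, and [g b] is redundant. *)
Lemma irredundant_support B b : irredundant B -> b \in B -> g b != 0 /\
  (exists2 c, dotp c (g b) = 0 & forall i, dotp c (g i) < 0 \/
     exists2 t, 0 <= t & g i = t *: g b).
Proof.
move=> [genB irrB] bB; have gb : g b != 0.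
  apply/eqP => gb; apply: (irrB b bB); rewrite gb.
  by exists (fun=> 0) => //; rewrite big1 // => i _; rewrite scale0r.
split => //.
pose ray i := `[< exists2 t, 0 <= t & g i = t *: g b >].
have [[c cb cn]|[l [l0 [i0 ri0 li0] [t le]]]] :=
    gordan_orthogonal (fun i => ~~ ray i) g (g b).
  exists c => // i; have [/asboolP ri|/cn] := boolP (ray i); first by right.
  by left.
have /boolp.choice[m mP] i :
    exists m, 0 <= m /\ cone (mem (B :\ b)) g (g i - m *: g b).
  have [k k0 ->] := genB i; exists (k b); split => //.
  rewrite (bigD1 b) //= addrAC subrr add0r; exists k => //.
  by apply: eq_bigl => j; rewrite !inE andbC.
pose Z := \sum_(i | ~~ ray i) l i *: (g i - m i *: g b).
have ZE : Z = (t - \sum_(i | ~~ ray i) l i * m i) *: g b.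
  rewrite scalerBl -le scaler_suml -sumrB; apply: eq_bigr => i _.
  by rewrite scalerBr scalerA.
have Zcone : cone (mem (B :\ b)) g Z.
  by apply: cone_sum => i _; apply: coneZ => //; case: (mP i).
have Zlt : dotp h Z < 0.
  rewrite dotp_sumr (bigD1 i0) //= ltr_nwDl //.
    rewrite dotpZr pmulr_rlt0 //; have [m0 mi0] := mP i0.
    apply: cone_lt0 hg mi0 _; apply: contra ri0; rewrite subr_eq0 => /eqP gi0.
    by apply/asboolP; exists (m i0).
  apply: sumr_le0 => i _; rewrite dotpZr mulr_ge0_le0 //; have [_ mi] := mP i.
  have [->|n0] := eqVneq (g i - m i *: g b) 0; first by rewrite dotp0r.
  by rewrite ltW // (cone_lt0 hg mi).
have s0 : 0 < t - \sum_(i | ~~ ray i) l i * m i.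
  by move: Zlt; rewrite ZE dotpZr nmulr_llt0 // hg.
exfalso; apply: (irrB b bB).
rewrite -[g b]scale1r -(mulVf (lt0r_neq0 s0)) -scalerA -ZE.
by apply: coneZ => //; rewrite invr_ge0 ltW.
Qed.

End ExtremeRays.

(** * Convex hulls, faces and dimension *)

Section Convexity.
Variables (R : realType) (d : nat).
Implicit Types (A : set 'rV[R]_d) (c x y v w : 'rV[R]_d).

Lemma convex_setP A : @convex_set R 'rV[R]_d A <->
  forall x y s, 0 <= s -> s <= 1 -> A x -> A y -> A (s *: x + (1 - s) *: y).
Proof.
split=> [cA x y s s0 s1 Ax Ay|cA x y s].
  by have := cA x y (Itv01 s0 s1); rewrite !inE; apply.
by rewrite !inE => Ax Ay; apply: cA.
Qed.

Lemma sub_conv_hull A x : A x -> conv_hull A x.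
Proof. by move=> Ax B [_]; exact. Qed.

Lemma conv_hull_convex A x y s : 0 <= s -> s <= 1 ->
  conv_hull A x -> conv_hull A y -> conv_hull A (s *: x + (1 - s) *: y).
Proof.
move=> s0 s1 hx hy B BP; case: (BP) => /convex_setP cB _.
by apply: cB => //; [apply: (hx B BP) | apply: (hy B BP)].
Qed.

Lemma conv_hull_comb (T : finType) (a : T -> 'rV[R]_d) x :
  conv_hull (range a) x -> exists l : T -> R,
  [/\ forall i, 0 <= l i, \sum_i l i = 1 & x = \sum_i l i *: a i].
Proof.
pose D := [set y | exists l : T -> R,
  [/\ forall i, 0 <= l i, \sum_i l i = 1 & y = \sum_i l i *: a i]]%classic.
move=> /(_ D); apply; split; last first => /=.
  move=> _ [i _ <-]; exists (fun j => (j == i)%:R); split => //.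
    by rewrite (bigD1 i) //= eqxx big1 ?addr0 // => j /negPf->.
  rewrite (bigD1 i) //= eqxx scale1r big1 ?addr0 // => j /negPf->.
  by rewrite scale0r.
apply/convex_setP => _ _ s s0 s1 [k [k0 k1 ->]] [l [l0 l1 ->]].
exists (fun i => s * k i + (1 - s) * l i); split.
- by move=> i; rewrite addr_ge0 // mulr_ge0 // subr_ge0.
- by rewrite big_split /= -!mulr_sumr k1 l1 !mulr1 addrC subrK.
- rewrite !scaler_sumr -big_split; apply: eq_bigr => i _ /=.
  by rewrite [RHS]scalerDl !scalerA.
Qed.

Lemma conv_hull_segment v w x : conv_hull [set v; w]%classic x <->
  exists s, [/\ 0 <= s, s <= 1 & x = v + s *: (w - v)].
Proof.
have E s : v + s *: (w - v) = s *: w + (1 - s) *: v.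
  by rewrite scalerBr scalerBl scale1r addrCA addrA.
split=> [|[s [s0 s1 ->]]]; last first.
  by rewrite E; apply: conv_hull_convex => //; apply: sub_conv_hull; [right|left].
pose D := [set y | exists s, [/\ 0 <= s, s <= 1 & y = v + s *: (w - v)]]%classic.
move=> /(_ D); apply; split; last first => /=.
  move=> _ [->|->]; first by exists 0; rewrite scale0r addr0 ler01.
  by exists 1; rewrite scale1r addrC subrK ler01.
apply/convex_setP => _ _ r r0 r1 [s [s0 s1 ->]] [t [t0 t1 ->]].
exists (r * s + (1 - r) * t); split.
- by rewrite addr_ge0 // mulr_ge0 // subr_ge0.
- have := ler_wpM2l r0 s1; have r1' : 0 <= 1 - r by rewrite subr_ge0.
  by have := ler_wpM2l r1' t1; lra.
- move: (w - v) => u; rewrite !scalerDr !scalerA addrACA -scalerDl.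
  rewrite [r + _]addrC subrK scale1r.
  by rewrite -scalerDl.
Qed.

Lemma is_face_sub (P F : set 'rV[R]_d) : is_face P F -> (F `<=` P)%classic.
Proof. by move=> [c [b [_ ->]]] x []. Qed.

Lemma sub_vertices (P F : set 'rV[R]_d) v :
  (F `<=` P)%classic -> F v -> vertices P v -> vertices F v.
Proof.
move=> FP Fv [c [b [cb vE]]]; exists c, b; split=> [x /FP/cb//|].
have [_ /= cv] : (P `&` [set x | dotp c x = b])%classic v by rewrite -vE.
rewrite eqEsubset; split=> [_ ->//|x [/FP Px cx]].
by rewrite vE.
Qed.

(** A linear form that is maximal on [F] at [x] only can attain the mean value
    at [x] only if it attains its maximum at one of the points with positive
    weight.  The missing weight [1 - \sum_i l i] sits at [v]. *)
Lemma vertices_subcomb (F : set 'rV[R]_d) (T : finType) (Q : pred T)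
    (l : T -> R) (p : T -> 'rV[R]_d) v x :
  vertices F x -> F v -> (forall i, Q i -> F (p i)) ->
  (forall i, 0 <= l i) -> \sum_(i | Q i) l i <= 1 ->
  x - v = \sum_(i | Q i) l i *: (p i - v) ->
  x = v \/ exists2 i, Q i & x = p i.
Proof.
move=> [c [b [cb xE]]] Fv Fp l0 l1 xp.
have [_ /= cx] : (F `&` [set x | dotp c x = b])%classic x by rewrite -xE.
have only y : F y -> dotp c y = b -> x = y.
  by move=> Fy cy; suff : [set x]%classic y by []; rewrite xE.
have [i /andP[Qi li]|l_0] := pickP [pred i | Q i && (l i != 0)]; last first.
  left; apply/eqP; rewrite -subr_eq0 xp big1 // => i Qi.
  by have := l_0 i; rewrite /= Qi => /negbT; rewrite negbK => /eqP->; rewrite scale0r.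
right; exists i => //; apply: only; first exact: Fp.
have /cb := Fp i Qi; rewrite le_eqVlt => /orP[/eqP//|lt]; exfalso.
suff : dotp c (x - v) < dotp c (x - v) by rewrite ltxx.
have cv0 : 0 <= b - dotp c v by rewrite subr_ge0 cb.
rewrite [ltRHS]dotpBr cx -[ltRHS]mul1r; apply: lt_le_trans (ler_wpM2r cv0 l1).
rewrite xp dotp_sumr mulr_suml (bigD1 i) //= [ltRHS](bigD1 i) //=.
apply: ltr_leD.
  by rewrite dotpZr dotpBr ltr_pM2l ?ltrD2r // lt_neqAle eq_sym li l0.
apply: ler_sum => j /andP[Qj _]; rewrite dotpZr dotpBr ler_wpM2l ?l0 //.
by rewrite lerD2r; apply/cb/Fp.
Qed.

(** Stated with a matrix [M] that need not have independent rows: for the edge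
    directions at a vertex, this is what bounds their rank from below. *)
Lemma affdim_le F r (M : 'M[R]_(r, d)) :
  (forall x y, F x -> F y -> (x - y <= M)%MS) -> (affdim F <= \rank M)%N.
Proof.
move=> FM; apply/bigmax_leqP => k /asboolP[p Fp]; rewrite /affine_indep => free.
rewrite -(eqP free); apply: mxrankS; apply/row_subP => i.
by rewrite rowK; apply: FM.
Qed.

Lemma affdim_ge F k (p : 'I_k.+1 -> 'rV[R]_d) :
  (forall i, F (p i)) -> affine_indep p -> (k <= affdim F)%N.
Proof.
move=> Fp pfree; have kd : (k < d.+1)%N.
  by rewrite ltnS -(eqP pfree) rank_leq_col.
by apply: (@leq_bigmax_cond _ _ _ (Ordinal kd)); apply/asboolP; exists p.
Qed.

Lemma affdim_segment v w : v <> w -> affdim (conv_hull [set v; w]%classic) = 1%N.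
Proof.
move=> vw; apply/eqP; rewrite eqn_leq; apply/andP; split.
  apply: leq_trans (rank_leq_row (w - v)); apply: affdim_le => x y.
  move=> /conv_hull_segment[s [_ _ ->]] /conv_hull_segment[t [_ _ ->]].
  by rewrite opprD addrACA subrr add0r -scalerBl scalemx_sub.
apply: (@affdim_ge _ 1 (fun i => if i == ord0 then v else w)) => [i|].
  by apply: sub_conv_hull; case: eqP; [left|right].
rewrite /affine_indep -row_leq_rank lt0n mxrank_eq0.
apply/eqP => M0; apply: vw; apply/eqP; rewrite eq_sym -subr_eq0.
by apply/eqP/rowP => j; have := congr1 (fun A : 'M_(1, d) => A 0 j) M0; rewrite !mxE.
Qed.

End Convexity.

(** * The tangent cone at a vertex is spanned by the edges *)

Section TangentCone.
Variables (R : realType) (d : nat) (T : finType) (a : T -> 'rV[R]_d).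
Implicit Types (c h u v w x : 'rV[R]_d).
Let P := conv_hull (range a).

Lemma conv_hull_sub_comb v x : P x -> exists l : T -> R,
  [/\ forall i, 0 <= l i, \sum_i l i = 1 & x - v = \sum_i l i *: (a i - v)].
Proof.
move=> /conv_hull_comb[l [l0 l1 ->]]; exists l; split => //.
rewrite -[in LHS](scale1r v) -l1 scaler_suml -sumrB.
by apply: eq_bigr => i _; rewrite scalerBr.
Qed.

Lemma vertex_exposed v : vertices P v ->
  exists h, forall i, a i - v != 0 -> dotp h (a i - v) < 0.
Proof.
move=> [h [b [hb vE]]]; exists h => i; apply: contra_neqT.
have Pi : P (a i) by apply: sub_conv_hull; exists i.
rewrite dotpBr subr_lt0 -leNgt => le; apply/eqP; rewrite subr_eq0; apply/eqP.
have [_ /= hv] : (P `&` [set x | dotp h x = b])%classic v by rewrite -vE.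
suff : (P `&` [set x | dotp h x = b])%classic (a i) by rewrite -vE.
by split => //=; apply/le_anti; rewrite (hb _ Pi) -hv.
Qed.

Lemma exposed_vertex k h :
  (forall i, a i - a k != 0 -> dotp h (a i - a k) < 0) -> vertices P (a k).
Proof.
move=> hk; have key x : P x -> x - a k != 0 -> dotp h (x - a k) < 0.
  move=> /(conv_hull_sub_comb (a k))[l [l0 _ ->]].
  apply: (@cone_lt0 _ _ _ predT _ _ _ hk).
  by exists l.
have Pk : P (a k) by apply: sub_conv_hull; exists k.
exists h, (dotp h (a k)); split=> [x Px|].
  rewrite -subr_le0 -dotpBr; have [->|/(key x Px)/ltW//] := eqVneq (x - a k) 0.
  by rewrite dotp0r.
rewrite eqEsubset; split=> [_ ->//|x [Px /= hx]].
apply/eqP; rewrite -subr_eq0; apply/negPn/negP => /(key x Px).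
by rewrite dotpBr hx subrr ltxx.
Qed.

(** The hyperplane orthogonal to [c] through [v] supports [P] and meets it in
    the part of the ray from [v] to [a b] that lies in [P].  This is the segment
    from [v] to the furthest [a k] on the ray, so it is an edge.  That [a k] is
    a vertex is seen by tilting [c] slightly in the direction [u] of the ray:
    this favours [a k] on the ray and does not disturb the points off it. *)
Lemma exists_neighbour_on_ray v b c : vertices P v -> a b - v != 0 ->
  dotp c (a b - v) = 0 ->
  (forall i, dotp c (a i - v) < 0 \/
     exists2 t, 0 <= t & a i - v = t *: (a b - v)) ->
  exists w, sk_adj P v w /\ exists2 s, 0 <= s & a b - v = s *: (w - v).
Proof.
set u := a b - v => Pv u0 cu rays.
have uu := dotp_gt0 u0.
pose ray i := `[< exists2 t, 0 <= t & a i - v = t *: u >].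
pose t i := dotp u (a i - v) / dotp u u.
have rayE i : ray i -> a i - v = t i *: u.
  by move=> /asboolP[s _ e]; rewrite /t e dotpZr mulfK ?gt_eqF.
have rayb : ray b by apply/asboolP; exists 1; rewrite ?scale1r.
have tb : t b = 1 by rewrite /t divff ?gt_eqF.
case: (arg_maxP t rayb) => k rayk tmax.
have tk : 1 <= t k by rewrite -tb; apply: tmax.
have tk0 : 0 < t k by apply: lt_le_trans tk.
have wE : a k - v = t k *: u by exact: rayE.
have cw : dotp c (a k - v) = 0 by rewrite wE dotpZr cu mulr0.
have offray i : ~~ ray i -> dotp c (a i - v) < 0.
  by move=> /asboolPn ni; case: (rays i).
have subw i : a i - a k = (a i - v) - (a k - v) by rewrite opprB addrA subrK.
have Pw : vertices P (a k).
  have [e e0 en] := exists_small_step (fun i => dotp u (a i - a k)) offray.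
  apply: (@exposed_vertex k (c + e *: u)) => i; rewrite dotpDl dotpZl.
  have [ri|/en + _] := boolP (ray i); last first.
    by rewrite [in X in _ -> X + _ < 0]subw [dotp c _ in X in _ -> X]dotpBr cw subr0.
  rewrite subw (rayE i ri) wE -scalerBl !dotpZr cu mulr0 add0r.
  rewrite scaler_eq0 negb_or subr_eq0 => /andP[tik _].
  rewrite pmulr_rlt0 // nmulr_rlt0 // subr_lt0 lt_neqAle tik.
  exact: tmax.
have vw : v <> a k.
  move=> E; move: wE; rewrite -E subrr => /esym/eqP.
  by rewrite scaler_eq0 (negPf u0) gt_eqF.
exists (a k); split; last first.
  exists (t k)^-1; first by rewrite invr_ge0 ltW.
  by rewrite wE scalerA mulVf ?scale1r // gt_eqF.
split => //; split; last exact: affdim_segment.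
have Pvv : P v by apply: (is_face_sub Pv).
have term_le i : dotp c (a i - v) <= 0.
  by have [/rayE->|/offray/ltW//] := boolP (ray i); rewrite dotpZr cu mulr0.
exists c, (dotp c v); split=> [x /(conv_hull_sub_comb v)[l [l0 _ xE]]|].
  rewrite -subr_le0 -dotpBr xE dotp_sumr; apply: sumr_le0 => i _.
  by rewrite dotpZr mulr_ge0_le0.
rewrite eqEsubset; split=> x.
  move=> /conv_hull_segment[s [s0 s1 ->]]; split => /=.
    rewrite scalerBr addrCA -[X in _ + (X - _)]scale1r -scalerBl.
    by apply: conv_hull_convex => //; apply: (is_face_sub Pw).
  by rewrite dotpDr dotpZr cw mulr0 addr0.
move=> [/(conv_hull_sub_comb v)[l [l0 l1 xE]] /= cx].
have l_off i : ~~ ray i -> l i = 0.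
  move=> ni; apply/eqP; rewrite eq_le l0 andbT leNgt; apply/negP => li.
  suff : dotp c (x - v) < 0 by rewrite dotpBr cx subrr ltxx.
  rewrite xE dotp_sumr (bigD1 i) //= ltr_nwDl //.
    by rewrite dotpZr pmulr_rlt0 // offray.
  by apply: sumr_le0 => j _; rewrite dotpZr mulr_ge0_le0.
have {}xE : x - v = (\sum_i l i * t i) *: u.
  rewrite xE scaler_suml; apply: eq_bigr => i _.
  have [/rayE->|/l_off->] := boolP (ray i); first by rewrite scalerA.
  by rewrite mul0r !scale0r.
apply/conv_hull_segment; exists ((\sum_i l i * t i) / t k); split.
- rewrite divr_ge0 ?(ltW tk0) // sumr_ge0 // => i _.
  have [/asboolP[s s0 e]|/l_off->] := boolP (ray i); last by rewrite mul0r.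
  by rewrite mulr_ge0 // /t e dotpZr mulfK ?gt_eqF.
- rewrite ler_pdivrMr // mul1r -[leRHS]mul1r -l1 mulr_suml; apply: ler_sum => i _.
  have [/tmax ti|/l_off->] := boolP (ray i); last by rewrite !mul0r.
  by rewrite ler_wpM2l.
- by rewrite wE scalerA divfK ?gt_eqF // -xE addrC subrK.
Qed.

Lemma sub_tangent_cone v (I : finType) (u : I -> 'rV[R]_d) x :
  vertices P v -> (forall w, sk_adj P v w -> exists j, w = u j) ->
  P x -> cone predT (fun j => u j - v) (x - v).
Proof.
move=> Pv nbr Px; have [h hv] := vertex_exposed Pv.
have [B Birr] := exists_irredundant (fun i => a i - v).
have [l [l0 _ ->]] := conv_hull_sub_comb v Px.
apply: cone_sum => i _; apply: coneZ => //.
apply: cone_trans (Birr.1 i) _ => b bB.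
have [gb0 [c cb rays]] := irredundant_support hv Birr bB.
have [w [/nbr[j ->] [s s0 ->]]] := exists_neighbour_on_ray Pv gb0 cb rays.
by apply: coneZ => //; exact: cone_gen.
Qed.

End TangentCone.

Lemma card_eq_enum (V : Type) (S : set V) n : (S #= `I_n)%card ->
  exists u : 'I_n -> V, forall w, S w <-> exists j, w = u j.
Proof.
move=> /card_set_bijP[f [fS finj fsurj]].
have /boolp.choice[u uP] (j : 'I_n) : exists w, S w /\ f w = j.
  by have [w Sw fw] := fsurj j (ltn_ord j); exists w.
exists u => w; split=> [Sw|[j ->]]; last by case: (uP j).
exists (Ordinal (fS w Sw)); have [Su fu] := uP (Ordinal (fS w Sw)).
by apply: finj; rewrite ?inE.
Qed.

(** * Simple polytopes *)

Section SimpleVertex.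
Variables (R : realType) (d : nat) (P : set 'rV[R]_d).
Implicit Types (c e u v w x : 'rV[R]_d).

Lemma polytope_range : is_polytope P ->
  exists m (a : 'I_m -> 'rV[R]_d), P = conv_hull (range a).
Proof.
move=> [A /finite_seqP[s ->] ->]; exists (size s), (tnth (in_tuple s)).
congr conv_hull; rewrite eqEsubset; split=> [x /= xs|_ [i _ <-]].
  have /tnthP[i ->] : x \in in_tuple s by [].
  by exists i.
exact: mem_tnth.
Qed.

Lemma polytope_sub_tangent_cone v (I : finType) (u : I -> 'rV[R]_d) x :
  is_polytope P -> vertices P v ->
  (forall w, sk_adj P v w -> exists j, w = u j) ->
  P x -> cone predT (fun j => u j - v) (x - v).
Proof. by move=> /polytope_range[m [a ->]]; exact: sub_tangent_cone. Qed.

Hypotheses (hP : is_polytope P) (hsimple : is_simple P).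

(** There are exactly [affdim P] edge directions, and by the tangent cone
    property their span contains all differences of points of [P]; so it has
    dimension at least [affdim P], which forces linear independence. *)
Lemma simple_vertex_basis v : vertices P v ->
  exists u : 'I_(affdim P) -> 'rV[R]_d,
  [/\ forall w, sk_adj P v w <-> exists j, w = u j,
      row_free (\matrix_j (u j - v)) &
      forall x, P x -> cone predT (fun j => u j - v) (x - v)].
Proof.
move=> Pv; have [u nbr] := card_eq_enum (hsimple Pv).
have P_cone x : P x -> cone predT (fun j => u j - v) (x - v).
  by apply: polytope_sub_tangent_cone => // w /nbr.
exists u; split => //; rewrite -row_leq_rank; apply: affdim_le => x y Px Py.
have sub z : P z -> (z - v <= \matrix_j (u j - v))%MS.
  move=> /P_cone[l _ ->]; apply: summx_sub => j _; apply: scalemx_sub.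
  by rewrite -(rowK (fun j => u j - v) j) row_sub.
have -> : x - y = (x - v) - (y - v) by rewrite opprB addrA subrK.
by rewrite addmx_sub ?eqmx_opp ?sub.
Qed.

(** The form is read off from the coordinates in the basis of edge
    directions, which are nonnegative on [P]. *)
Lemma simple_vertex_functional v (S : pred 'rV[R]_d) : vertices P v ->
  exists e, (forall w, sk_adj P v w -> dotp e (w - v) = (S w)%:R) /\
            (forall x, P x -> 0 <= dotp e (x - v)).
Proof.
move=> /simple_vertex_basis[u [nbr ufree P_cone]].
pose N := \matrix_j (u j - v); pose e := (pinvmx N *m \col_j (S (u j))%:R)^T.
have eu j : dotp e (u j - v) = (S (u j))%:R.
  rewrite dotpC /dotp trmxK -(rowK (fun j => u j - v) j) -row_mul mulmxA.
  by rewrite mulmxVp // mul1mx !mxE.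
exists e; split=> [w /nbr[j ->]//|x /P_cone[l l0 ->]].
rewrite dotp_sumr; apply: sumr_ge0 => j _.
by rewrite dotpZr eu mulr_ge0 // ler0n.
Qed.

End SimpleVertex.

Theorem theorem4p4 (R : realType) (d : nat) (P : set 'rV[R]_d)
    (hP : is_polytope P) (hsimple : is_simple P) :
  clique_face_property P.
Proof.
move=> K [KP Kadj].
have [->|/set0P[v Kv]] := eqVneq K set0.
  exists set0.
    (* the empty set is the face on which the zero form takes the value 1 *)
    exists 0, 1; split=> [x _|]; first by rewrite dotpC dotp0r.
    rewrite eqEsubset; split=> // x [_ /=]; rewrite dotpC dotp0r => /eqP.
    by rewrite eq_sym oner_eq0.
  by rewrite eqEsubset; split=> // x Vx; have := is_face_sub Vx; exact.
have Pv : vertices P v := KP v Kv.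
have vP x : vertices P x -> P x by move=> Px; apply: (is_face_sub Px).
have [e [eN eP]] :=
  simple_vertex_functional hP hsimple (fun w => `[< ~ K w >]) Pv.
pose F := (P `&` [set x | dotp e x = dotp e v])%classic.
have Fface : is_face P F.
  exists (-1 *: e), (- dotp e v); split=> [x /eP|].
    by rewrite dotpZl mulN1r lerN2 dotpBr subr_ge0.
  rewrite /F; congr (_ `&` _)%classic; apply/seteqP.
  split=> x /=; rewrite dotpZl mulN1r.
    by move->.
  by move=> /oppr_inj.
have KF : (K `<=` F)%classic.
  move=> w Kw; split; first exact/vP/KP.
  have [->//|/eqP wv] := eqVneq w v; apply/eqP; rewrite -subr_eq0 -dotpBr.
  rewrite eN; last by apply: Kadj => // /esym.
  by rewrite asboolF //; exact.
exists F => //; rewrite eqEsubset; split=> [w Kw|x Fx].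
  by apply: (sub_vertices (is_face_sub Fface)); [exact: KF|exact: KP].
have [Px /= ex] : F x by apply: (is_face_sub Fx).
have [u [nbr ufree P_cone]] := simple_vertex_basis hP hsimple Pv.
have [mu mu0 xE] := P_cone x Px.
pose inK j := `[< K (u j) >].
have {}xE : x - v = \sum_(j | inK j) mu j *: (u j - v).
  rewrite xE [RHS]big_mkcond /=; apply: eq_bigr => j _.
  case: ifPn => // /asboolPn nKj.
  suff -> : mu j = 0 by rewrite scale0r.
  have eu i : dotp e (u i - v) = (`[< ~ K (u i) >])%:R by apply/eN/nbr; exists i.
  have : dotp e (x - v) = 0 by rewrite dotpBr ex subrr.
  rewrite xE dotp_sumr => /eqP; rewrite psumr_eq0 => [|i _].
    move=> /allP/(_ j (mem_index_enum _)) /=; rewrite dotpZr eu.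
    by rewrite asboolT // mulr1 => /eqP.
  by rewrite dotpZr eu mulr_ge0.
have mu1 : \sum_(j | inK j) mu j <= 1.
  have [j0 Kj0|noK] := pickP inK; last by rewrite big_pred0 ?ler01.
  have /asboolP Kw := Kj0; set w := u j0 in Kw.
  have [f [fN fP]] := simple_vertex_functional hP hsimple (pred1 v) (KP w Kw).
  have vw : v <> w by have [] : sk_adj P v w by apply/nbr; exists j0.
  have fv : dotp f (v - w) = 1 by rewrite fN /= ?eqxx //; apply/Kadj => // /esym.
  have fu j : inK j -> dotp f (u j - w) = 0.
    move=> /asboolP Ku; have [->|/eqP uw] := eqVneq (u j) w.
      by rewrite subrr dotp0r.
    rewrite fN; last by apply/Kadj => // /esym.
    have [_ _ vu _] : sk_adj P v (u j) by apply/nbr; exists j.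
    by have /eqP/negPf := vu; rewrite eq_sym /= => ->.
  (* [f] takes the value [1 - \sum_(j | inK j) mu j] at [x - w] *)
  have := fP x Px; have -> : x - w = (x - v) + (v - w) by rewrite addrA subrK.
  rewrite dotpDr fv xE dotp_sumr (eq_bigr (fun j => - mu j)) => [|j Kj].
    by rewrite sumrN addrC subr_ge0.
  have -> : u j - v = (u j - w) - (v - w) by rewrite opprB addrA subrK.
  by rewrite dotpZr dotpBr fu // fv sub0r mulrN1.
have Fp j : inK j -> F (u j) by move=> /asboolP/KF.
have [->//|[j /asboolP Kj ->//]] := vertices_subcomb Fx (KF v Kv) Fp mu0 mu1 xE.
Qed.
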